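(* Let $\mathbb{F}$ be a field; for every finite group $G$ considered below assume $\mathrm{char}(\mathbb{F})\nmid |G|$. For a finite group $G$ consider the conditions: (S) $\beta(H)<\beta(G)$ for each proper subgroup $H$ of $G$; (F) $\beta(G/N)<\beta(G)$ for each non-trivial normal subgroup $N$ of $G$. Then condition (S) holds for any finite nilpotent group $G$. Moreover, both (S) and (F) hold when (1) $G$ is abelian; (2) $G$ has a cyclic subgroup of index two; (3) $G\cong C_p\rtimes C_q$ (a semidirect product that is not a direct product) for odd primes $p,q$ where $q\mid p-1$; (4) $G$ has order less than $32$.
   Context: A $G$-module is a finite dimensional $\mathbb{F}$-vector space $V$ with a linear action of $G$. $S(V)$ is the symmetric algebra of $V$ (a polynomial algebra on a basis of $V$, with each variable of degree one), on which $G$ acts by $\mathbb{F}$-algebra automorphisms extending the action on $V$, and $S(V)^G$ is the subalgebra of $G$-invariants. $\beta(S(V)^G)$ is the minimal non-negative integer $d$ such that the $\mathbb{F}$-algebra $S(V)^G$ is generated by its homogeneous components of degree at most $d$. The Noether number is $\beta(G)=\beta^{\mathbb{F}}(G)=\sup\{\beta(S(V)^G): V \text{ is a } G\text{-module over }\mathbb{F}\}$. $C_n$ denotes the cyclic group of order $n$. *)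

(* Defs.v *)
From mathcomp Require Import all_boot all_order all_algebra all_fingroup.
From mathcomp Require Import all_solvable all_character.
From mathcomp Require Import boolp classical_sets mpoly.
(* The notations of mpoly and of constructive_ereal cannot coexist. *)
From mathcomp Require Import -(notations) constructive_ereal.

Set Implicit Arguments.
Unset Strict Implicit.
Unset Printing Implicit Defensive.

Import Order.TTheory GRing.Theory Num.Theory.

Local Open Scope ring_scope.

(* A G-module is given as a matrix representation rG of degree n acting on the
   row vectors V = 'rV[F]_n. S(V) is then {mpoly F[n]}, the variable 'X_i being
   the i-th standard basis vector e_i of V. Since e_i *m rG g is the i-th row
   of rG g, act_poly rG g is the algebra endomorphism extending v |-> v *m rG g
   (a right action, as usual for mx_representation). *)
Definition act_poly (F : fieldType) (gT : finGroupType) (G : {group gT})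
    (n : nat) (rG : mx_representation F G n) (g : gT) (p : {mpoly F[n]}) :
    {mpoly F[n]} :=
  p \mPo [tuple \sum_(j < n) rG g i j *: 'X_j | i < n].

Definition invariants (F : fieldType) (gT : finGroupType) (G : {group gT})
    (n : nat) (rG : mx_representation F G n) : set {mpoly F[n]} :=
  [set p | forall g : gT, g \in G -> act_poly rG g p = p]%classic.

Definition generated_subalgebra (F : fieldType) (n : nat)
    (A : set {mpoly F[n]}) : set {mpoly F[n]} :=
  smallest (fun B : set {mpoly F[n]} => GRing.subalg_closed (mem B)) A.

Definition generated_in_degree_le (F : fieldType) (gT : finGroupType)
    (G : {group gT}) (n : nat) (rG : mx_representation F G n) (d : nat) : Prop :=
  generated_subalgebra
    [set p | invariants rG p /\
             exists k : nat, (k <= d)%N /\ p \is k.-homog]%classic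
  = invariants rG.

(* Both numbers below live in the extended integers. The out-of-range values
   are EPInf, if there is no such d, resp. if the beta_module rG are unbounded;
   beta_moduleP and noether_numberP check that one gets a minimum and a
   supremum. *)
Definition beta_module (F : fieldType) (gT : finGroupType) (G : {group gT})
    (n : nat) (rG : mx_representation F G n) : extended int :=
  infimum (EPInf int)
    [set EFin (d%:Z) | d in [set d | generated_in_degree_le rG d]]%classic.

Definition noether_number (F : fieldType) (gT : finGroupType)
    (G : {group gT}) : extended int :=
  supremum (ENInf int)
    [set b | exists (n : nat) (rG : mx_representation F G n),
               b = beta_module rG]%classic.

Lemma beta_moduleP (F : fieldType) (gT : finGroupType) (G : {group gT})
    (n : nat) (rG : mx_representation F G n) (d : nat) :
  generated_in_degree_le rG d ->
  (forall e : nat, generated_in_degree_le rG e -> (d <= e)%N) ->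
  beta_module rG = EFin (d%:Z).
Proof.
move=> gd dmin; rewrite /beta_module; set A := (X in infimum _ X).
have Ad : A (EFin d%:Z) by exists d.
have infd : infimums A (EFin d%:Z).
  split=> [_ [e ge <-]|b]; last exact.
  by rewrite lee_fin lez_nat; apply: dmin.
rewrite /infimum ifF; last by apply/eqP => A0; rewrite A0 in Ad.
by case: xgetP => [y _ infy|/(_ _ infd)//]; apply: is_subset1_infimums infy infd.
Qed.

Lemma beta_module_ge0 (F : fieldType) (gT : finGroupType) (G : {group gT})
    (n : nat) (rG : mx_representation F G n) :
  (EFin 0%:Z <= beta_module rG)%O.
Proof.
have [[d gd]|ngd] := pselect (exists d, generated_in_degree_le rG d).
  have exd : exists e, `[< generated_in_degree_le rG e >].
    by exists d; apply/asboolP.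
  case: (ex_minnP exd) => e /asboolP ge emin.
  rewrite (@beta_moduleP _ _ _ _ _ e) ?lee_fin ?lez_nat//.
  by move=> f /asboolP; exact: emin.
rewrite /beta_module /infimum ifT ?leey//; apply/eqP/seteqP; split=> //.
by move=> b [d gd _]; case: ngd; exists d.
Qed.

Lemma noether_numberP (F : fieldType) (gT : finGroupType) (G : {group gT}) :
  supremums [set b | exists (n : nat) (rG : mx_representation F G n),
                       b = beta_module rG]%classic (noether_number F G).
Proof.
rewrite /noether_number; set A := (X in supremums X).
have Areg : A (beta_module (regular_repr F G)) by exists _, (regular_repr F G).
suff [s sups] : exists s, supremums A s.
  rewrite /supremum ifF; last by apply/eqP => /seteqP[/(_ _ Areg)].
  by case: xgetP => // /(_ s).
have ub_ge0 u : ubound A u -> (EFin 0%:Z <= u)%O.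
  by move=> /(_ _ Areg); apply: le_trans; exact: beta_module_ge0.
have [[m um]|nub] := pselect (exists m : nat, ubound A (EFin m%:Z)).
  have exm : exists k : nat, `[< ubound A (EFin k%:Z) >].
    by exists m; apply/asboolP.
  case: (ex_minnP exm) => k /asboolP uk kmin.
  exists (EFin k%:Z); split=> // -[[l|l]| |] ub.
  - by rewrite lee_fin lez_nat; apply: kmin; apply/asboolP.
  - by have := ub_ge0 _ ub; rewrite lee_fin.
  - exact: leey.
  - by have := ub_ge0 _ ub.
exists (EPInf int); split=> [b _|]; first exact: leey.
move=> [[l|l]| |] ub //.
- by case: nub; exists l.
- by have := ub_ge0 _ ub; rewrite lee_fin.
- by have := ub_ge0 _ ub.
Qed.

Definition condition_S (F : fieldType) (gT : finGroupType) (G : {group gT}) :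
    Prop :=
  forall H : {group gT}, H \proper G ->
    (noether_number F H < noether_number F G)%O.

Definition condition_F (F : fieldType) (gT : finGroupType) (G : {group gT}) :
    Prop :=
  forall N : {group gT}, (N <| G)%g -> N :!=: 1%g ->
    (noether_number F (G / N)%G < noether_number F G)%O.

(* Main.v *)
From HB Require Import structures.
Require Import Defs.
From mathcomp Require Import all_boot all_order all_algebra all_fingroup.
From mathcomp Require Import all_solvable all_character.
From mathcomp Require Import boolp classical_sets mpoly.
From mathcomp Require Import -(notations) constructive_ereal.

Set Implicit Arguments.
Unset Strict Implicit.
Unset Printing Implicit Defensive.

Import Order.TTheory GRing.Theory Num.Theory.

Local Open Scope ring_scope.

(** Write S = S(V), let S_+ be the polynomials without constant term, S^G_+ the
    invariants in S_+, and I = S S^G_+ the Hilbert ideal, so that S / I is the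
    algebra of coinvariants. The argument is uniform in the finite group G, of
    order invertible in F, and compares the Noether numbers through the degrees
    in which some algebra of coinvariants is nonzero.

    Averaging over G, an invariant that lies in S_+ I is a sum of products of two
    elements of S^G_+ (max_hilbert_decomposable). So a homogeneous invariant f
    that is needed as a generator lies outside S_+ I; writing f as a combination
    of the variables shows that S / I is nonzero in degree deg f - 1
    (form_outside_hilbert_ideal). Conversely, suppose that a form h of degree m is
    outside I. Adjoin a regular summand to V, with basis t_g permuted by G. The
    invariant sum_g g (t_1 h) of degree m + 1 is indecomposable, because reading
    off the coefficient of t_1 at t = 0 is a derivation which recovers h from it
    and maps every product of positive invariants into I
    (indecomposable_of_coinvariants). Hence coinvariants of G in degree m force
    the Noether number to be at least m + 1 (noether_ge_of_coinvariants), and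
    strictness amounts to gaining one degree of coinvariants.

    Subgroups (coinvariants_of_proper_subgroup). Let f in S(W)^H be homogeneous
    of degree d, outside S(W)_+ I(W). Let V be the free module with basis the
    pairs (x, w_i), x a group element and w_i in a basis of W. It has an
    H-linear map q onto W, sending (x, w) to w x if x is in H and to 0
    otherwise. For g in G outside H, the lift f' of f to the vectors (1, w) is
    mapped by q to f and by q o g to 0. Both maps agree on the invariants b of
    G, so a relation f' = sum a b gives f = sum (q a - q (g a)) q b, which is in
    S(W)_+ I(W). So f' is a nonzero coinvariant of degree d, where H was only
    known to have one of degree d - 1.

    Quotients (coinvariants_of_quotient). Let h be a nonzero coinvariant of G / N
    in degree m and let x be a nontrivial element of N. On V plus a regular
    summand, x fixes V, so the coefficients of t_1 and of t_x at t = 0 agree on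
    invariants; their difference is a derivation vanishing on them, and it sends
    t_1 h to h. So t_1 h is a nonzero coinvariant of degree m + 1.

    Strict inequalities need finite numbers. This is Noether's degree bound, for
    which homog_in_hilbert_ideal gives Benson's argument that I contains all forms
    of degree at least |G|. *)

(** * Linear substitutions and homogeneous components *)

Section LinearSubstitution.

Variable F : fieldType.

(** The rows of M as linear forms: composing with them is the algebra map
    S('rV_n) -> S('rV_m) that extends right multiplication by M. *)
Definition linforms (n m : nat) (M : 'M[F]_(n, m)) : n.-tuple {mpoly F[m]} :=
  [tuple \sum_(j < m) M i j *: 'X_j | i < n].

Lemma linformsX n m (M : 'M[F]_(n, m)) i :
  'X_i \mPo linforms M = \sum_(j < m) M i j *: 'X_j.
Proof. by rewrite comp_mpolyXU -tnth_nth tnth_mktuple. Qed.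

Lemma comp_mpolyA n m k (lq : n.-tuple {mpoly F[m]}) (lr : m.-tuple {mpoly F[k]})
    (p : {mpoly F[n]}) :
  (p \mPo lq) \mPo lr = p \mPo [tuple tnth lq i \mPo lr | i < n].
Proof.
rewrite [p \mPo lq]comp_mpolyEX [RHS]comp_mpolyEX raddf_sum /=.
apply: eq_bigr => a _; rewrite linearZ /= !comp_mpolyX rmorph_prod; congr (_ *: _).
by apply: eq_bigr => i _; rewrite rmorphXn /= tnth_mktuple.
Qed.

(** Functoriality, which reduces identities between the algebra maps below to
    identities between matrices. *)
Lemma linforms_comp n m k (M : 'M[F]_(n, m)) (N : 'M[F]_(m, k)) p :
  (p \mPo linforms M) \mPo linforms N = p \mPo linforms (M *m N).
Proof.
rewrite comp_mpolyA; congr (_ \mPo _); apply: eq_from_tnth => i.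
rewrite !tnth_mktuple raddf_sum /=.
under eq_bigr => j _ do rewrite linearZ /= linformsX scaler_sumr.
rewrite exchange_big; apply: eq_bigr => l _ /=.
by rewrite mxE scaler_suml; apply: eq_bigr => j _; rewrite scalerA.
Qed.

Lemma linforms1 n (p : {mpoly F[n]}) : p \mPo linforms 1%:M = p.
Proof.
rewrite -[RHS]comp_mpoly_id; congr (_ \mPo _); apply: eq_from_tnth => i.
rewrite !tnth_mktuple (bigD1 i) //= mxE eqxx scale1r big1 ?addr0 // => j ji.
by rewrite mxE eq_sym (negPf ji) scale0r.
Qed.

Lemma meval_at0 n (p : {mpoly F[n]}) : p.@[fun=> 0] = p@_0%MM.
Proof.
rewrite mevalE [in RHS](mpolyE p) raddf_sum /=; apply: eq_bigr => m _.
rewrite mcoeffZ mcoeffX; congr (_ * _).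
case: eqP => [->|/eqP nm]; first by rewrite big1 // => i _; rewrite mnm0E.
have [i mi] : exists i, m i != 0%N.
  apply/existsP; rewrite -negb_forall; apply: contraNN nm => /forallP m0.
  by apply/eqP/mnmP => i; rewrite mnm0E; apply/eqP/m0.
by rewrite (bigD1 i) //= expr0n (negPf mi) mul0r.
Qed.

Lemma mcoeff0_linforms n m (M : 'M[F]_(n, m)) p :
  (p \mPo linforms M)@_0%MM = p@_0%MM.
Proof.
rewrite -!meval_at0 comp_mpoly_meval; apply: meval_eq => i.
rewrite tnth_mktuple raddf_sum big1 // => j _.
by rewrite /= mevalZ mevalXU mulr0.
Qed.

Lemma mcoeff0_homog n d (p : {mpoly F[n]}) :
  p \is d.-homog -> (0 < d)%N -> p@_0%MM = 0.
Proof.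
by move=> hp d0; apply: dhomog_nemf_coeff hp _; rewrite /= mdeg0 eq_sym -lt0n.
Qed.

Lemma pihomog_neq n d e (p : {mpoly F[n]}) :
  p \is d.-homog -> pihomog mdeg e p = if d == e then p else 0.
Proof.
by case: eqP => [<- /pihomog_dE //|/eqP]; exact: pihomog_ne0.
Qed.

Lemma pihomog0E n (p : {mpoly F[n]}) : pihomog mdeg 0 p = (p@_0%MM)%:MP.
Proof.
rewrite pihomogE [in RHS](mpolyE p) raddf_sum /= rmorph_sum /= big_mkcond /=.
apply: eq_bigr => m _; rewrite mcoeffZ mcoeffX mdeg_eq0.
by case: eqP => [->|_]; rewrite ?mulr1 ?mpolyX0 ?alg_mpolyC // mulr0 mpolyC0.
Qed.

Lemma linforms_homog n m (M : 'M[F]_(n, m)) d p :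
  p \is d.-homog -> p \mPo linforms M \is d.-homog.
Proof.
move=> /dhomogP hp; rewrite comp_mpolyEX big_seq; apply: rpred_sum => a ap.
apply: rpredZ; rewrite comp_mpolyX -(hp a ap) /= mdegE.
elim/big_rec2: _ => [|i k q _ IH]; first exact: dhomog1.
apply: dhomogM => //; rewrite -[X in X.-homog]mul1n; apply: dhomogMn.
rewrite tnth_mktuple; apply: rpred_sum => j _; apply: rpredZ.
by rewrite dhomogX /= mdeg1.
Qed.

Lemma pihomog_linforms n m (M : 'M[F]_(n, m)) d p :
  pihomog mdeg d (p \mPo linforms M) = pihomog mdeg d p \mPo linforms M.
Proof.
rewrite [in LHS](pihomog_partitionE (leqnn (msize p))).
rewrite [in RHS](pihomog_partitionE (leqnn (msize p))).
rewrite (raddf_sum (comp_mpoly (linforms M))).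
rewrite [pihomog mdeg d (\sum_(i < _) pihomog _ _ _)]raddf_sum.
rewrite (raddf_sum (comp_mpoly (linforms M))) (raddf_sum (pihomog mdeg d)) /=.
apply: eq_bigr => k _; have hk := pihomogP mdeg k p.
rewrite (pihomog_neq _ (linforms_homog _ hk)) (pihomog_neq _ hk).
by case: eqP => // _; rewrite raddf0.
Qed.

Lemma pihomogM n d (p q : {mpoly F[n]}) :
  pihomog mdeg d (p * q) =
  \sum_(k < d.+1) pihomog mdeg k p * pihomog mdeg (d - k) q.
Proof.
pose P k := pihomog mdeg k p; pose Q k := pihomog mdeg k q.
have hP k : P k \is k.-homog by exact: pihomogP.
have hQ k : Q k \is k.-homog by exact: pihomogP.
have hPQ k l : P k * Q l \is (k + l).-homog by exact: dhomogM.
rewrite [in LHS](pihomog_partitionE (leqnn (msize p))) mulr_suml.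
rewrite (raddf_sum (pihomog mdeg d)) /=.
under eq_bigr => k _.
  rewrite [X in _ * X](pihomog_partitionE (leqnn (msize q))) mulr_sumr.
  rewrite (raddf_sum (pihomog mdeg d)) /=.
  under eq_bigr => l _ do rewrite (pihomog_neq _ (hPQ k l)).
  over.
under [RHS]eq_bigr => j _.
  rewrite [X in pihomog _ j X](pihomog_partitionE (leqnn (msize p))).
  rewrite [X in _ * pihomog _ _ X](pihomog_partitionE (leqnn (msize q))).
  rewrite (raddf_sum (pihomog mdeg j)) (raddf_sum (pihomog mdeg (d - j))).
  rewrite mulr_suml /=.
  under eq_bigr => k _.
    rewrite mulr_sumr /= (pihomog_neq _ (hP k)).
    under eq_bigr => l _ do rewrite /= (pihomog_neq _ (hQ l)).
    over.
  over.
rewrite [RHS]exchange_big; apply: eq_bigr => k _ /=.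
rewrite [RHS]exchange_big; apply: eq_bigr => l _ /=.
have [kld|kld] := eqVneq (k + l)%N d.
  have kd : (k < d.+1)%N by rewrite ltnS -kld leq_addr.
  rewrite (bigD1 (Ordinal kd)) //= big1 => [|j].
    by rewrite eqxx -kld addKn eqxx addr0.
  by rewrite -val_eqE /= eq_sym => /negPf ->; rewrite mul0r.
rewrite big1 // => j _; case: eqP => [kj|_]; last by rewrite mul0r.
case: eqP => [lj|_]; last by rewrite mulr0.
by case/eqP: kld; rewrite kj lj subnKC // -ltnS.
Qed.

(** A substitute for Euler's relation that is valid in every characteristic. *)
Lemma homog_sum_vars n d (p : {mpoly F[n]}) :
  p \is d.+1.-homog ->
  exists2 h : 'I_n -> {mpoly F[n]},
    forall i, h i \is d.-homog & p = \sum_(i < n) h i * 'X_i.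
Proof.
move=> /dhomogP hp; rewrite (mpolyE p) big_seq.
elim/big_ind: _ => [|q r [h hh ->] [k hk ->]|m mp].
- by exists (fun=> 0) => [i|]; rewrite ?rpred0 // big1 // => i _; rewrite mul0r.
- exists (fun i => h i + k i) => [i|]; first exact: rpredD.
  by rewrite -big_split; apply: eq_bigr => i _; rewrite mulrDl.
have /= dm := hp m mp.
have [i mi] : exists i, m i != 0%N.
  apply/existsP; rewrite -negb_forall; apply/negP => /forallP m0.
  by move: dm; rewrite mdegE big1 // => i _; apply/eqP/m0.
have Um : (U_(i) <= m)%MM.
  by apply/mnm_lepP => j; rewrite mnm1E; case: eqP => // <-; rewrite lt0n.
exists (fun j => if j == i then p@_m *: 'X_[m - U_(i)] else 0) => [j|].
  case: eqP => _; rewrite ?rpred0 //; apply: rpredZ; rewrite dhomogX /=.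
  by rewrite -(eqn_add2r 1) -(mdeg1 i) -mdegD submK // dm mdeg1 addn1.
rewrite (bigD1 i) //= eqxx big1 => [|j /negPf->]; last by rewrite mul0r.
by rewrite addr0 -scalerAl -mpolyXD submK.
Qed.

Lemma homog_linforms0 n m d (p : {mpoly F[n]}) :
  p \is d.-homog -> (0 < d)%N -> p \mPo linforms (0 : 'M_(n, m)) = 0.
Proof.
case: d => // d /homog_sum_vars[h _ ->] _; rewrite raddf_sum big1 // => i _ /=.
rewrite rmorphM /= linformsX big1 ?mulr0 // => j _.
by rewrite mxE scale0r.
Qed.

End LinearSubstitution.

(** * Hilbert ideal and decomposable invariants *)

Section SumsOfProducts.

Variable F : fieldType.

(** An inductive predicate rather than a finite sum, so that a relation
    p = sum a b is transported along additive maps by induction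
    (sum_of_products_map). *)
Inductive sum_of_products n (A B : {mpoly F[n]} -> Prop) : {mpoly F[n]} -> Prop :=
| sum_of_products0 : sum_of_products A B 0
| sum_of_productsMD a b p :
    A a -> B b -> sum_of_products A B p -> sum_of_products A B (a * b + p).

Lemma sum_of_productsM n (A B : {mpoly F[n]} -> Prop) a b :
  A a -> B b -> sum_of_products A B (a * b).
Proof.
by move=> Aa Bb; rewrite -[_ * _]addr0; apply: sum_of_productsMD => //; left.
Qed.

Lemma sum_of_productsD n (A B : {mpoly F[n]} -> Prop) p q :
  sum_of_products A B p -> sum_of_products A B q -> sum_of_products A B (p + q).
Proof.
elim=> [|a b r Aa Bb _ IH] sq; first by rewrite add0r.
by rewrite -addrA; apply: sum_of_productsMD => //; exact: IH.
Qed.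

Lemma sum_of_products_sum n (A B : {mpoly F[n]} -> Prop) (I : Type) (r : seq I)
    (P : pred I) (f : I -> {mpoly F[n]}) :
  (forall i, P i -> sum_of_products A B (f i)) ->
  sum_of_products A B (\sum_(i <- r | P i) f i).
Proof.
move=> sf; elim/big_ind: _ => //; first by left.
exact: sum_of_productsD.
Qed.

Lemma sum_of_products_map n m (A B : {mpoly F[n]} -> Prop)
    (A' B' : {mpoly F[m]} -> Prop) (f : {additive {mpoly F[n]} -> {mpoly F[m]}}) p :
  (forall a b, A a -> B b -> sum_of_products A' B' (f (a * b))) ->
  sum_of_products A B p -> sum_of_products A' B' (f p).
Proof.
move=> fM; elim=> [|a b q Aa Bb _ IH]; first by rewrite raddf0; left.
by rewrite raddfD; apply: sum_of_productsD => //; exact: fM.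
Qed.

Lemma sum_of_products_mul n (A B : {mpoly F[n]} -> Prop) c p :
  (forall a, A a -> A (c * a)) ->
  sum_of_products A B p -> sum_of_products A B (c * p).
Proof.
move=> cA; apply: (sum_of_products_map (f := GRing.mull_fun c idfun)) => a b Aa Bb /=.
by rewrite mulrA; apply: sum_of_productsM; auto.
Qed.

End SumsOfProducts.

Section Invariants.

Variables (F : fieldType) (gT : finGroupType) (G : {group gT}) (n : nat).
Variable rG : mx_representation F G n.
Implicit Types p q f h : {mpoly F[n]}.

Definition positive_invariant p := invariants rG p /\ p@_0%MM = 0.

Definition hilbert_ideal := sum_of_products (fun=> True) positive_invariant.

(** The product of the maximal homogeneous ideal with the Hilbert ideal. *)
Definition max_hilbert_ideal :=
  sum_of_products (fun a => a@_0%MM = 0) positive_invariant.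

(** The square of the ideal of positive invariants in the ring of invariants. *)
Definition decomposable := sum_of_products positive_invariant positive_invariant.

Lemma act_polyE g p : act_poly rG g p = p \mPo linforms (rG g).
Proof. by []. Qed.

Lemma act_polyM g k p : g \in G -> k \in G ->
  act_poly rG k (act_poly rG g p) = act_poly rG (g * k)%g p.
Proof. by move=> gG kG; rewrite !act_polyE linforms_comp repr_mxM. Qed.

Lemma act_poly1 p : act_poly rG 1 p = p.
Proof. by rewrite act_polyE repr_mx1 linforms1. Qed.

Lemma sum_act_invariant p : invariants rG (\sum_(g in G) act_poly rG g p).
Proof.
move=> k kG; rewrite act_polyE raddf_sum [RHS](reindex_inj (mulIg k)) /=.
apply: eq_big => [g|g gG]; first by rewrite groupMr.
by rewrite -act_polyM.
Qed.

Lemma sum_act_mull a b :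
  invariants rG b ->
  \sum_(g in G) act_poly rG g (a * b) = (\sum_(g in G) act_poly rG g a) * b.
Proof.
move=> ib; rewrite mulr_suml; apply: eq_bigr => g gG.
by rewrite act_polyE rmorphM /= -!act_polyE ib.
Qed.

Lemma act_poly_mcoeff0 g p : (act_poly rG g p)@_0%MM = p@_0%MM.
Proof. exact: mcoeff0_linforms. Qed.

(** Averaging is linear over the invariants, so it replaces the arbitrary
    cofactors of a relation by invariant ones without changing f. *)
Lemma max_hilbert_decomposable f :
  #|G|%:R != 0 :> F -> invariants rG f -> max_hilbert_ideal f -> decomposable f.
Proof.
move=> nzG invf If.
have avgf : \sum_(g in G) act_poly rG g f = #|G|%:R *: f.
  rewrite (eq_bigr (fun=> f)) => [|g gG]; last exact: invf.
  by rewrite sumr_const scaler_nat.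
have -> : f = #|G|%:R^-1%:MP * \sum_(g in G) act_poly rG g f.
  by rewrite avgf mul_mpolyC scalerA mulVf // scale1r.
have invC (c : F) : invariants rG c%:MP by move=> g _; exact: comp_mpolyC.
apply: sum_of_products_mul => [a [inva a0]|].
  split=> [g gG|]; last by rewrite rmorphM /= a0 mulr0.
  by rewrite act_polyE rmorphM /= -!act_polyE invC // inva.
elim: If => [|a b q a0 [invb b0] _ IH].
  by rewrite big1 => [|g _]; [left | rewrite act_polyE raddf0].
under eq_bigr => g _ do rewrite act_polyE raddfD /= -!act_polyE.
rewrite big_split sum_act_mull //; apply: sum_of_productsMD => //; split=> //.
  exact: sum_act_invariant.
by rewrite raddf_sum big1 // => g _; rewrite /= act_poly_mcoeff0.
Qed.

Lemma invariants_subalg : GRing.subalg_closed (mem (invariants rG)).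
Proof.
have invE p : (p \in mem (invariants rG)) <-> invariants rG p.
  by split=> [/set_mem|/mem_set].
split=> [|c p q /invE ip /invE iq|p q /invE ip /invE iq]; apply/invE => g gG.
- by rewrite act_polyE rmorph1.
- by rewrite act_polyE linearP /= -!act_polyE ip // iq.
- by rewrite act_polyE rmorphM /= -!act_polyE ip // iq.
Qed.

Lemma pihomog_invariant d p : invariants rG p -> invariants rG (pihomog mdeg d p).
Proof.
by move=> ip g gG; rewrite act_polyE -pihomog_linforms; congr pihomog; exact: ip.
Qed.

Lemma mcoeff0_pihomog d p : (0 < d)%N -> (pihomog mdeg d p)@_0%MM = 0.
Proof. by move=> d0; apply: mcoeff0_homog d0; exact: pihomogP. Qed.

(** The graded Nakayama argument: a decomposable homogeneous invariant is a
    polynomial in invariants of smaller degree, so one can induct on the degree. *)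
Lemma generated_of_decomposable d :
  (forall m f, (d < m)%N -> f \is m.-homog -> invariants rG f -> decomposable f) ->
  generated_in_degree_le rG d.
Proof.
move=> dec; apply/seteqP; split=> [p|p ip B [[B1 BZD BM] AB]].
  apply; split=> [|q [] //]; exact: invariants_subalg.
have BE q : (q \in mem B) <-> B q by split=> [/set_mem|/mem_set].
have B0 : B 0 by apply: AB; split=> [g _|]; [exact: raddf0|exists 0%N; rewrite rpred0].
have BD q r : B q -> B r -> B (q + r).
  by move=> /BE Bq /BE Br; apply/BE; have := BZD 1 _ _ Bq Br; rewrite scale1r.
have Bhom m q : q \is m.-homog -> invariants rG q -> B q.
  elim/ltn_ind: m q => m IH q hq iq.
  have [md|dm] := leqP m d; first by apply: AB; split=> //; exists m.
  rewrite -(pihomog_dE hq); elim: (dec m q dm hq iq) => [|a b r [ia a0] [ib b0] _ Br].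
    by rewrite pihomog0.
  rewrite pihomogD; apply: (BD) => //; rewrite pihomogM.
  apply: (big_ind B B0 BD) => -[k /=]; rewrite ltnS => km _.
  have [->|k0] := posnP k; first by rewrite pihomog0E a0 mpolyC0 mul0r.
  have [mk|mk] := posnP (m - k); first by rewrite mk pihomog0E b0 mpolyC0 mulr0.
  apply/BE/BM; apply/BE.
    apply: (IH k); [by rewrite -subn_gt0|exact: pihomogP|exact: pihomog_invariant].
  apply: (IH (m - k)%N); [|exact: pihomogP|exact: pihomog_invariant].
  by rewrite ltn_subrL k0 (leq_trans k0 km).
rewrite (pihomog_partitionE (leqnn (msize p))).
apply: (big_ind B B0 BD) => k _; apply: Bhom (pihomogP _ _ _) _.
exact: pihomog_invariant.
Qed.

(** The invariants whose components of degree above d are all decomposable form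
    a subalgebra, which contains the invariants of degree at most d. *)
Lemma decomposable_of_generated d m f :
  generated_in_degree_le rG d -> (d < m)%N -> f \is m.-homog ->
  invariants rG f -> decomposable f.
Proof.
move=> gen dm hf invf.
pose B : set {mpoly F[n]} :=
  [set p | invariants rG p /\
           forall e, (d < e)%N -> decomposable (pihomog mdeg e p)]%classic.
suff BE : B f by have [_ /(_ m dm)] := BE; rewrite pihomog_dE.
have decC c p : decomposable p -> decomposable (c%:MP * p).
  apply: sum_of_products_mul => a [ia a0]; split; last by rewrite rmorphM /= a0 mulr0.
  by move=> g gG; rewrite act_polyE rmorphM /= -!act_polyE ia // [X in X * _]comp_mpolyC.
move: invf; rewrite -gen; apply; split; last first.
  move=> p [ip [k [kd hp]]]; split=> // e de.
  by rewrite (pihomog_neq _ hp) ifF ?ltn_eqF ?(leq_ltn_trans kd) //; left.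
have BE p : (p \in mem B) <-> B p by split=> [/set_mem|/mem_set].
have [I1 IZ IM] := invariants_subalg.
have inE' p : (p \in mem (invariants rG)) <-> invariants rG p.
  by split=> [/set_mem|/mem_set].
split=> [|c p q /BE[ip dp] /BE[iq dq]|p q /BE[ip dp] /BE[iq dq]]; apply/BE; split.
- exact/inE'.
- move=> e de; rewrite (pihomog_neq _ (dhomog1 _ _)) ifF; first by left.
  by apply/eqP => e0; rewrite -e0 in de.
- by apply/inE'/IZ; apply/inE'.
- move=> e de; rewrite linearP /= -mul_mpolyC; apply: sum_of_productsD; last exact: dq.
  by apply: decC; exact: dp.
- by apply/inE'/IM; apply/inE'.
move=> e de; rewrite pihomogM; apply: sum_of_products_sum => -[k /=].
rewrite ltnS => ke _; have [->|k0] := posnP k.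
  by rewrite pihomog0E subn0; apply: decC; exact: dq.
have [ek|ek] := posnP (e - k).
  have -> : k = e by apply/eqP; rewrite eqn_leq ke -subn_eq0 ek.
  by rewrite subnn pihomog0E mulrC; apply: decC; exact: dp.
apply: sum_of_productsM; split; try exact: pihomog_invariant; exact: mcoeff0_pihomog.
Qed.

End Invariants.

(** * Degree bounds for coinvariants *)

Section NoetherBound.

Variables (F : fieldType) (gT : finGroupType) (G : {group gT}) (n : nat).
Variable rG : mx_representation F G n.
Hypothesis nzG : #|G|%:R != 0 :> F.

Lemma hilbert_idealM (c p : {mpoly F[n]}) :
  hilbert_ideal rG p -> hilbert_ideal rG (c * p).
Proof. exact: sum_of_products_mul. Qed.

(** Benson's identity. For each g in G the product over s in G of
    g (s^-1 f_s) - f_s vanishes, its factor at s = g being zero. Sum over g and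
    expand: the term of the empty subset is |G| times the product of the f_s up
    to sign, and every other term has the factor sum_g g (prod_(s in J) s^-1 f_s),
    a positive invariant. *)
Lemma prod_in_hilbert_ideal (f : 'I_#|G| -> {mpoly F[n]}) :
  (forall i, (f i)@_0%MM = 0) -> hilbert_ideal rG (\prod_i f i).
Proof.
move=> f0; pose s (i : 'I_#|G|) := enum_val i.
have sG i : s i \in G by exact: enum_valP.
pose a i := act_poly rG (s i)^-1 (f i).
pose t (J : {set 'I_#|G|}) := (\sum_(g in G) act_poly rG g (\prod_(i in J) a i)) *
            \prod_(i | i \notin J) (- f i).
have sum_t : \sum_J t J = 0.
  transitivity (\sum_(g in G) \prod_i (act_poly rG g (a i) + - f i)); last first.
    apply: big1 => g gG; have [i si] : exists i, s i = g.
      by exists (enum_rank_in gG g); rewrite /s enum_rankK_in.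
    rewrite (bigD1 i) //= /a act_polyM ?groupV // -si mulVg act_poly1 subrr.
    by rewrite mul0r.
  under [RHS]eq_bigr => g _ do rewrite bigA_distr.
  rewrite exchange_big; apply: eq_bigr => J _ /=; rewrite /t mulr_suml.
  by apply: eq_bigr => g gG; rewrite big_if act_polyE rmorph_prod.
have tJ (J : {set _}) : J != finset.set0 -> hilbert_ideal rG (t J).
  case/set0Pn => j jJ; rewrite /t mulrC; apply: sum_of_productsM => //.
  split; first exact: sum_act_invariant.
  rewrite raddf_sum big1 // => g gG; rewrite /= act_poly_mcoeff0 rmorph_prod.
  by rewrite (bigD1 j) //= /a act_poly_mcoeff0 f0 mul0r.
have t0 : t finset.set0 = #|G|%:R%:MP * ((-1) ^+ #|G| * \prod_i f i).
  rewrite /t; congr (_ * _).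
    transitivity (\sum_(g in G) (1 : {mpoly F[n]})).
      apply: eq_bigr => g _.
      by rewrite big1 ?act_polyE ?rmorph1 // => i; rewrite inE.
    by rewrite sumr_const -mpolyC_nat.
  rewrite (eq_bigl xpredT) => [|i]; last by rewrite inE.
  by rewrite prodrN card_ord.
have -> : \prod_i f i = (- ((-1) ^+ #|G| * #|G|%:R^-1%:MP)) * - t finset.set0.
  rewrite mulrNN t0 -mulrA [_%:MP * (_%:MP * _)]mulrA -mpolyCM mulVf // mpolyC1 mul1r.
  by rewrite mulrA -expr2 sqrr_sign mul1r.
apply: hilbert_idealM; move/eqP: sum_t; rewrite (bigD1 finset.set0) //= addr_eq0.
move=> /eqP ->; rewrite opprK; apply: sum_of_products_sum => J.
by move=> /tJ.
Qed.

(** Variables are split off one at a time until |G| of them are available for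
    prod_in_hilbert_ideal. *)
Lemma homog_in_hilbert_ideal m (h : {mpoly F[n]}) :
  h \is m.-homog -> (#|G| <= m)%N -> hilbert_ideal rG h.
Proof.
(* v lists the variables split off so far, r the number still to come. *)
suff prod_vars r (v : seq 'I_n) k : (size v + r)%N = #|G| -> (r <= k)%N ->
    forall q, q \is k.-homog -> hilbert_ideal rG (q * \prod_(i <- v) 'X_i).
  move=> hh Gm; have := prod_vars #|G| [::] m erefl Gm h hh.
  by rewrite big_nil mulr1.
elim: r v k => [|r IH] v k sz rk q hq.
  apply: hilbert_idealM; rewrite addn0 in sz.
  case: v sz => [|i v] sz; first by have := cardG_gt0 G; rewrite -sz.
  rewrite (big_nth i) big_mkord sz; apply: prod_in_hilbert_ideal => j.
  by apply: mcoeff0_homog (ltnSn 0); rewrite dhomogX /= mdeg1.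
case: k rk hq => // k rk /homog_sum_vars[c hc ->].
rewrite mulr_suml; apply: sum_of_products_sum => i _; rewrite -mulrA.
by have := IH (i :: v) k _ rk (c i) (hc i); rewrite big_cons; apply; rewrite -sz addSnnS.
Qed.

(** If the coefficients of f on the variables were all in the Hilbert ideal, then
    f would be in the product of this ideal with the maximal one. *)
Lemma form_outside_hilbert_ideal m (f : {mpoly F[n]}) :
  f \is m.+1.-homog -> ~ max_hilbert_ideal rG f ->
  exists2 h, h \is m.-homog & ~ hilbert_ideal rG h.
Proof.
move=> /homog_sum_vars[h hh ->] nIf.
apply: contrapT => nh; apply: nIf; apply: sum_of_products_sum => i _.
have : hilbert_ideal rG (h i) by apply: contrapT => nhi; apply: nh; exists (h i).
rewrite mulrC; elim=> [|a b q _ b0 _ IH]; first by rewrite mulr0; left.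
rewrite mulrDr mulrA; apply: sum_of_productsMD => //.
rewrite rmorphM /= [X in X * _](_ : _ = 0) ?mul0r //.
by apply: mcoeff0_homog (ltnSn 0); rewrite dhomogX /= mdeg1.
Qed.

End NoetherBound.

(** The algebra of coinvariants S(V) / S(V) S(V)^G_+ is nonzero in degree m for
    some G-module V. *)
Definition coinvariants_in_degree (F : fieldType) (gT : finGroupType)
    (G : {group gT}) (m : nat) : Prop :=
  exists (n : nat) (rG : mx_representation F G n) (h : {mpoly F[n]}),
    h \is m.-homog /\ ~ hilbert_ideal rG h.

(** * Coinvariants of proper subgroups *)

(** The free module: k copies of the group algebra of the whole of gT, whose basis
    is permuted by right translation. Restricted to G it is free again, and no
    transversal has to be chosen. *)
Section TranslationRepr.

Variables (F : fieldType) (gT : finGroupType) (G : {group gT}) (k : nat).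

Definition translate (g : gT) (i : 'I_#|{: gT * 'I_k}|) :=
  enum_rank ((enum_val i).1 * g, (enum_val i).2)%g.

Definition translation_mx (g : gT) : 'M[F]_#|{: gT * 'I_k}| :=
  rowsub (translate g) 1%:M.

Lemma mul_translation_mx m g (A : 'M[F]_(#|{: gT * 'I_k}|, m)) :
  translation_mx g *m A = rowsub (translate g) A.
Proof. by rewrite mul_rowsub_mx mul1mx. Qed.

Lemma translation_mx_repr : mx_repr G translation_mx.
Proof.
split=> [|g h _ _]; apply/matrixP => i j; rewrite ?mul_translation_mx !mxE.
  by rewrite /translate mulg1 -surjective_pairing enum_valK.
by rewrite /translate enum_rankK mulgA.
Qed.

Definition translation_repr := MxRepresentation translation_mx_repr.

End TranslationRepr.

Section Subgroup.

Variables (F : fieldType) (gT : finGroupType) (G H : {group gT}).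

(** A generator of degree m for H, which gives coinvariants of H in degree m - 1,
    gives coinvariants of G in degree m. The subspace of V spanned by the basis
    vectors (1, i) is a copy of W which q maps identically and which the composite
    of g and q kills. *)
Lemma coinvariants_of_proper_subgroup n (rH : mx_representation F H n) m
    (f : {mpoly F[n]}) :
  H \proper G -> (0 < m)%N -> f \is m.-homog -> ~ max_hilbert_ideal rH f ->
  coinvariants_in_degree F G m.
Proof.
case/properP=> sHG [g gG gH] m0 hf nIf; pose rG := translation_repr F G n.
(* s embeds W at the identity of G, and q evaluates the translates by H. *)
pose s : 'M[F]_(n, _) :=
  rowsub (fun i : 'I_n => enum_rank (1%g : gT, i)) 1%:M.
pose q : 'M[F]_(#|{: gT * 'I_n}|, n) :=
  \matrix_(i, j) let: (x, l) := enum_val i in if x \in H then rH x l j else 0.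
exists _, rG, (f \mPo linforms s); split; first exact: linforms_homog.
have sM l (A : 'M[F]_(_, l)) : s *m A = rowsub (fun i => enum_rank (1%g, i)) A.
  by rewrite mul_rowsub_mx mul1mx.
have sq : s *m q = 1%:M.
  by apply/matrixP => i j; rewrite sM mxE mxE enum_rankK group1 repr_mx1.
have sgq : s *m (rG g *m q) = 0.
  apply/matrixP => i j; rewrite sM mul_translation_mx !mxE.
  by rewrite /translate !enum_rankK /= mul1g (negPf gH).
have qH x : x \in H -> rG x *m q = q *m rH x.
  move=> xH; apply/matrixP => i j; rewrite mul_translation_mx !mxE.
  rewrite /translate enum_rankK; case E: (enum_val i) => [y l] /=.
  rewrite groupMr //; case: ifP => yH.
    by rewrite repr_mxM // mxE; apply: eq_bigr => a _; rewrite mxE E yH.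
  by rewrite big1 // => a _; rewrite mxE E yH mul0r.
(* The restrictions along q and along g then q agree on the invariants of G. *)
pose phi := comp_mpoly (linforms q) \- comp_mpoly (linforms (rG g *m q)).
have phi_f : phi (f \mPo linforms s) = f.
  by rewrite /phi /= !linforms_comp sq sgq linforms1 (homog_linforms0 _ hf) ?subr0.
move=> If; apply: nIf; rewrite -phi_f.
apply: sum_of_products_map If => a b _ [ib b0] /=.
rewrite !rmorphM /= -[b \mPo linforms (rG g *m q)]linforms_comp.
rewrite -act_polyE ib // -mulrBl; apply: sum_of_productsM.
  by rewrite raddfB /= !mcoeff0_linforms subrr.
split=> [x xH|]; last by rewrite mcoeff0_linforms.
rewrite act_polyE linforms_comp -qH // -linforms_comp -act_polyE ib //.
exact: fintype.subsetP xH.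
Qed.

End Subgroup.

(** * Slopes along a summand *)

Section Slope.

Variables (F : fieldType) (n k : nat).

(** The derivative at t = 0 of a polynomial on V + U along the functional c of U.
    Instead of a combination of partial derivatives, the variables of U are first
    replaced by the multiples c_j e of one variable e and the coefficient of e is
    read off: a group element then acts on the substitution matrix only, and no
    chain rule is needed. *)
Definition slope (c : 'cV[F]_k) : {mpoly F[n + k]} -> {mpoly F[n]} :=
  comp_mpoly (linforms (col_mx 1%:M 0)) \o mderiv (rshift n (ord0 : 'I_1))
    \o comp_mpoly (linforms (block_mx 1%:M 0 0 c)).

Lemma slope_is_zmod_morphism c : zmod_morphism (slope c).
Proof. by move=> p q; rewrite /slope /= !raddfB. Qed.

HB.instance Definition _ c :=
  GRing.isZmodMorphism.Build {mpoly F[n + k]} {mpoly F[n]} (slope c)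
    (slope_is_zmod_morphism c).

(** A derivation over the restriction to V. *)
Lemma slopeM c p q :
  slope c (p * q) = slope c p * (q \mPo linforms (col_mx 1%:M 0)) +
                    (p \mPo linforms (col_mx 1%:M 0)) * slope c q.
Proof.
have res r : (r \mPo linforms (block_mx 1%:M 0 0 c)) \mPo linforms (col_mx 1%:M 0)
           = r \mPo linforms (col_mx 1%:M 0) :> {mpoly F[n]}.
  by rewrite linforms_comp mul_block_col !mulmx1 !mulmx0 !addr0.
by rewrite /slope /= rmorphM /= mderivM rmorphD !rmorphM /= !res.
Qed.

(** The product of h, a polynomial on V, with the vector s of U. *)
Definition times_vector (s : 'rV[F]_k) (h : {mpoly F[n]}) : {mpoly F[n + k]} :=
  ('X_ord0 \mPo linforms (row_mx 0 s)) * (h \mPo linforms (row_mx 1%:M 0)).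

Lemma slope_times_vector c s h (A : 'M_n) (B : 'M_k) :
  slope c (times_vector s h \mPo linforms (block_mx A 0 0 B)) =
  (s *m B *m c) 0 0 *: (h \mPo linforms A).
Proof.
have rowB l (u : 'M_(l, n)) (w : 'M_(l, k)) :
    row_mx u w *m block_mx A 0 0 B *m block_mx 1%:M 0 0 c = row_mx (u *m A) (w *m B *m c).
  by rewrite !mul_row_block !(mulmx1, mulmx0, mul0mx, addr0, add0r).
rewrite /slope /times_vector /= !rmorphM /= !linforms_comp !mulmxA !rowB !mul0mx mul1mx.
rewrite linformsX big_split_ord /= big_ord1 big1 ?add0r => [|j _]; last first.
  by rewrite row_mxEl mxE scale0r.
rewrite row_mxEr mderivM mderivZ mderivX mnm1E eqxx scale1r.
rewrite (_ : U_(_) - U_(_) = 0)%MM ?mpolyX0; last first.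
  by apply/mnmP => j; rewrite mnmBE subnn mnm0E.
rewrite rmorphD !rmorphM /= !linforms_comp !linearZ /= rmorph1 linformsX.
rewrite [X in _ + _ *: X * _]big1 => [|j _]; last by rewrite col_mxEd mxE scale0r.
rewrite scaler0 mul0r addr0 -scalerAl mul1r.
by rewrite mul_row_col mulmx1 mulmx0 addr0.
Qed.

Lemma times_vector_homog s h m :
  h \is m.-homog -> times_vector s h \is m.+1.-homog.
Proof.
move=> hh; rewrite -add1n; apply: dhomogM; apply: linforms_homog => //.
by rewrite dhomogX /= mdeg1.
Qed.

End Slope.

(** * Indecomposable invariants from coinvariants *)

Section RegularSummand.

Variables (F : fieldType) (gT : finGroupType) (G : {group gT}).
Variables (n : nat) (rV : mx_representation F G n).

Definition regular_extension : mx_representation F G (n + #|{: gT * 'I_1}|) :=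
  dadd_grepr (Representation rV) (Representation (translation_repr F G 1)).

Lemma regular_extensionE g :
  regular_extension g = block_mx (rV g) 0 0 (translation_mx F 1 g).
Proof. by []. Qed.

Definition unit_index : 'I_#|{: gT * 'I_1}| := enum_rank (1%g : gT, ord0 : 'I_1).

Definition unit_row : 'rV[F]_#|{: gT * 'I_1}| := delta_mx 0 unit_index.

Definition unit_col : 'cV[F]_#|{: gT * 'I_1}| := delta_mx unit_index 0.

(** The coefficient of t_1 in the vector t_g. *)
Lemma unit_translate g :
  (unit_row *m translation_mx F 1 g *m unit_col) 0 0 = (g == 1%g)%:R.
Proof.
rewrite -mulmxA mul_translation_mx -rowE !mxE eqxx andbT /translate.
rewrite (inj_eq enum_rank_inj) enum_rankK /= mul1g.
by rewrite xpair_eqE eqxx andbT.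
Qed.

Lemma restrict_positive_invariant b :
  positive_invariant regular_extension b ->
  positive_invariant rV (b \mPo linforms (col_mx 1%:M 0)).
Proof.
move=> [ib b0]; split; last by rewrite mcoeff0_linforms.
move=> g gG; rewrite act_polyE linforms_comp mul_col_mx mul1mx mul0mx.
rewrite -[in RHS](ib g gG) act_polyE linforms_comp regular_extensionE.
by rewrite mul_block_col !(mulmx1, mulmx0, mul0mx, addr0).
Qed.

(** The slope along t_1 recovers h from the orbit sum of t_1 h, since only the term
    of the identity contributes; by the product rule it maps a product of two
    positive invariants into the Hilbert ideal of V. *)
Lemma indecomposable_of_coinvariants m (h : {mpoly F[n]}) :
  h \is m.-homog -> ~ hilbert_ideal rV h ->
  exists f, [/\ f \is m.+1.-homog, invariants regular_extension f &
               ~ decomposable regular_extension f].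
Proof.
move=> hh nIh.
pose f := \sum_(g in G) act_poly regular_extension g (times_vector unit_row h).
exists f; split.
- by apply: rpred_sum => g _; apply/linforms_homog/times_vector_homog.
- exact: sum_act_invariant.
move=> df; apply: nIh.
have -> : h = slope unit_col f.
  rewrite /f raddf_sum (bigD1 1%g) //= big1 => [|g /andP[gG g1]].
    rewrite act_polyE regular_extensionE slope_times_vector unit_translate eqxx.
    by rewrite scale1r -act_polyE act_poly1 addr0.
  rewrite act_polyE regular_extensionE slope_times_vector unit_translate.
  by rewrite (negPf g1) scale0r.
apply: (sum_of_products_map (f := slope unit_col)) df => a b pa pb.
rewrite /= slopeM.
apply: sum_of_productsD; last rewrite mulrC; apply: sum_of_productsM => //;
  exact: restrict_positive_invariant.
Qed.

End RegularSummand.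

(** * Coinvariants of proper quotients *)

Section Quotient.

Variables (F : fieldType) (gT : finGroupType) (G N : {group gT}).
Hypothesis nNG : (N <| G)%g.
Variables (n : nat) (rQ : mx_representation F (G / N)%g n).

Lemma inflation_mx_repr : mx_repr G (fun g => rQ (coset N g)).
Proof.
have nG g : g \in G -> g \in 'N(N)%g by apply/fintype.subsetP/normal_norm.
split=> [|g h gG hG]; first by rewrite morph1 repr_mx1.
by rewrite morphM ?nG // repr_mxM ?mem_quotient.
Qed.

Definition inflation := MxRepresentation inflation_mx_repr.

(** The slopes along t_1 and along its translate by x in N agree on invariants,
    because x fixes V; on t_1 h the first is h and the second 0. *)
Lemma coinvariants_of_quotient m (h : {mpoly F[n]}) :
  N :!=: 1%g -> h \is m.-homog -> ~ hilbert_ideal rQ h ->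
  coinvariants_in_degree F G m.+1.
Proof.
case/trivgPn => x xN x1 hh nIh; pose rG := regular_extension inflation.
have xG : x \in G by apply: fintype.subsetP xN; exact: normal_sub.
pose c := unit_col F gT; pose xc := translation_mx F 1 x *m c.
exists _, rG, (times_vector (unit_row F gT) h); split; first exact: times_vector_homog.
have inf_x : inflation x = 1%:M.
  by rewrite -[LHS]/(rQ (coset N x)) coset_id // repr_mx1.
have slope_x b : slope c (act_poly rG x b) = slope xc b.
  rewrite /slope /= act_polyE linforms_comp regular_extensionE mulmx_block.
  by rewrite inf_x !(mulmx1, mulmx0, mul0mx, addr0, add0r).
pose phi := @slope F n _ c \- @slope F n _ xc.
have slope_act g : g \in G ->
    slope c (act_poly rG g (times_vector (unit_row F gT) h)) =
    (g == 1%g)%:R *: (h \mPo linforms (inflation g)).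
  by move=> gG; rewrite act_polyE regular_extensionE slope_times_vector unit_translate.
have phi_h : phi (times_vector (unit_row F gT) h) = h.
  rewrite /phi /= -slope_x slope_act // (negPf x1) scale0r subr0.
  rewrite -[times_vector _ _](act_poly1 rG) slope_act // eqxx scale1r.
  by rewrite -act_polyE act_poly1.
move=> Ih; apply: nIh; rewrite -phi_h.
apply: (sum_of_products_map (f := phi)) Ih => a b _ pb.
have [ib b0] := restrict_positive_invariant pb; have [irb _] := pb.
have slope_b : slope xc b = slope c b by rewrite -slope_x irb.
rewrite /phi /= 2!slopeM slope_b opprD addrACA [X in _ + X]subrr addr0 -mulrBl.
apply: sum_of_productsM; first exact: I.
split; last exact: b0.
by move=> _ /morphimP[g gN gG ->]; exact: (ib g gG).
Qed.

End Quotient.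

(** * Comparison of Noether numbers *)

Section NoetherNumber.

Variables (F : fieldType) (gT : finGroupType) (G : {group gT}).
Hypothesis nzG : #|G|%:R != 0 :> F.

(** Noether's degree bound makes beta_module a natural number. *)
Lemma beta_module_spec n (rG : mx_representation F G n) :
  exists d : nat, [/\ beta_module rG = EFin d%:Z, (d <= #|G|)%N,
    generated_in_degree_le rG d &
    forall e, generated_in_degree_le rG e -> (d <= e)%N].
Proof.
have genG : generated_in_degree_le rG #|G|.
  apply: generated_of_decomposable => -[//|m] f Gm hf invf.
  apply: max_hilbert_decomposable => //; apply: contrapT => nIf.
  have [h hh []] := form_outside_hilbert_ideal hf nIf.
  exact: homog_in_hilbert_ideal hh Gm.
have exd : exists e, `[< generated_in_degree_le rG e >] by exists #|G|; apply/asboolP.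
case: (ex_minnP exd) => d /asboolP gend dmin; exists d; split=> //.
- by apply: beta_moduleP => // e /asboolP; exact: dmin.
- by apply: dmin; apply/asboolP.
- by move=> e /asboolP; exact: dmin.
Qed.

Lemma beta_module_le_noether n (rG : mx_representation F G n) :
  (beta_module rG <= noether_number F G)%O.
Proof. by have [ub _] := noether_numberP F G; apply: ub; exists n, rG. Qed.

Lemma noether_number_finite : exists d : int, noether_number F G = EFin d.
Proof.
have [_ lub] := noether_numberP F G.
have leG : (noether_number F G <= EFin #|G|%:Z)%O.
  apply: lub => _ [n [rG ->]]; have [d [-> dG _ _]] := beta_module_spec rG.
  by rewrite lee_fin lez_nat.
have ge0 := le_trans (beta_module_ge0 (regular_repr F G))
                     (beta_module_le_noether (regular_repr F G)).
by case: (noether_number F G) leG ge0 => [d||] // _ _; exists d.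
Qed.

Lemma noether_ge_of_coinvariants m :
  coinvariants_in_degree F G m -> (EFin m.+1%:Z <= noether_number F G)%O.
Proof.
move=> [n [rG [h [hh nIh]]]].
have [f [hf invf ndf]] := indecomposable_of_coinvariants hh nIh.
apply: le_trans (beta_module_le_noether (regular_extension rG)).
have [d [-> _ gend _]] := beta_module_spec (regular_extension rG).
rewrite lee_fin lez_nat leqNgt; apply/negP => dm; apply: ndf.
exact: decomposable_of_generated gend dm hf invf.
Qed.

Lemma coinvariants_in_degree0 : coinvariants_in_degree F G 0.
Proof.
exists _, (regular_repr F G), 1; split; first exact: dhomog1.
move=> I1; have: (1 : {mpoly F[#|G|]})@_0%MM = 0.
  elim: I1 => [|a b p _ [_ b0] _ p0]; first by rewrite raddf0.
  by rewrite mcoeffD rmorphM /= b0 p0 mulr0 addr0.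
by move/eqP; rewrite rmorph1 oner_eq0.
Qed.

End NoetherNumber.

(** If beta_module rH is e + 1 then rH has a homogeneous invariant of degree
    m > e outside S_+ I, since otherwise the invariants would be generated in
    degree at most e. The resulting coinvariants of G in degree m push its Noether
    number to at least m + 1 > e + 1. *)
Lemma noether_number_lt (F : fieldType) (gT hT : finGroupType)
    (G : {group gT}) (H : {group hT}) :
  #|G|%:R != 0 :> F -> #|H|%:R != 0 :> F ->
  (forall n (rH : mx_representation F H n) m f, (0 < m)%N ->
     f \is m.-homog -> ~ max_hilbert_ideal rH f -> coinvariants_in_degree F G m) ->
  (noether_number F H < noether_number F G)%O.
Proof.
move=> nzG nzH lift; have [d dE] := noether_number_finite nzG.
rewrite dE; apply: (@le_lt_trans _ _ (EFin (d - 1))); last first.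
  by rewrite lte_fin ltrBlDr ltrDl.
have [_ lub] := noether_numberP F H; apply: lub => _ [n [rH ->]].
have [e [-> _ _ emin]] := beta_module_spec nzH rH; rewrite lee_fin.
have below m : coinvariants_in_degree F G m -> (m%:Z <= d - 1)%R.
  move=> /(noether_ge_of_coinvariants nzG); rewrite dE lee_fin.
  by rewrite lerBrDr -[m.+1]addn1 PoszD.
(* The coinvariant 1 of degree 0 makes the Noether number of G positive. *)
case: e emin => [|e] emin; first exact/below/coinvariants_in_degree0.
have [] := pselect (exists m (f : {mpoly F[n]}),
  [/\ (e < m)%N, f \is m.-homog & ~ max_hilbert_ideal rH f]).
  move=> [m [f [em hf nIf]]]; apply: le_trans (below m _); first by rewrite lez_nat.
  by apply: lift hf nIf; exact: leq_ltn_trans em.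
move=> all_in; have := emin e; rewrite ltnn => absurd.
suff: false by []; apply: absurd; apply: generated_of_decomposable => m f em hf invf.
apply: max_hilbert_decomposable => //; apply: contrapT => nIf; apply: all_in.
by exists m, f.
Qed.

Lemma condition_S_nonmodular (F : fieldType) (gT : finGroupType) (G : {group gT}) :
  ([pchar F]^'.-group G)%g -> condition_S F G.
Proof.
move=> charG H prH; have sHG := proper_sub prH.
apply: noether_number_lt => [||n rH m f m0 hf nIf].
- by rewrite -pcharf'_nat.
- by rewrite -pcharf'_nat; exact: pgroupS charG.
exact: coinvariants_of_proper_subgroup prH m0 hf nIf.
Qed.

Lemma condition_F_nonmodular (F : fieldType) (gT : finGroupType) (G : {group gT}) :
  ([pchar F]^'.-group G)%g -> condition_F F G.
Proof.
move=> charG N nNG ntN; apply: noether_number_lt => [||n rQ [//|m] f _ hf nIf].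
- by rewrite -pcharf'_nat.
- by rewrite -pcharf'_nat; exact: quotient_pgroup.
have [h hh nIh] := form_outside_hilbert_ideal hf nIf.
exact: coinvariants_of_quotient ntN hh nIh.
Qed.

Local Close Scope ring_scope.

Theorem theorem4p5 (F : fieldType) (gT : finGroupType) (G : {group gT})
    (charG : ([pchar F]%R^'.-group G)%g) :
  (nilpotent G -> condition_S F G) /\
  ([\/ abelian G,
       exists C : {group gT}, [/\ C \subset G, cyclic C & #|G : C|%g = 2],
       exists p q : nat, exists P Q : {group gT},
         [/\ prime p /\ odd p, prime q /\ odd q, q %| p.-1,
             [/\ cyclic P, #|P| = p, cyclic Q & #|Q| = q] &
             (P ><| Q = G /\ P \x Q <> G)%g]
     | #|G| < 32] ->
   condition_S F G /\ condition_F F G).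
Proof.
have SG := condition_S_nonmodular charG; have FG := condition_F_nonmodular charG.
by split.
Qed.
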